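(* Let $F\subseteq\mathbb{R}^n$ and $f\colon\mathbb{R}^n\to\mathbb{R}$. Let $(\mathcal{C},\mathcal{D},g,z,\mathcal{T},\epsilon)$ be an $(F,f)$-valid configuration with $\emptyset\in\mathcal{D}$. Then there exists no $x\in F$ with $f(x)<z$.
   Context: Constraints are arbitrary subsets of $\mathbb{R}^n$. For $\mathcal{C}\subseteq\mathcal{P}(\mathbb{R}^n)$ (power set) write $\bigcap\mathcal{C}=\bigcap_{C\in\mathcal{C}}C$, with $\bigcap\emptyset=\mathbb{R}^n$. For a list $\tau=(i_1,\dots,i_k)\in\{\pm1,\dots,\pm n\}^k$ write $\tau(x)=(\mathrm{sgn}(i_1)x_{|i_1|},\dots,\mathrm{sgn}(i_k)x_{|i_k|})\in\mathbb{R}^k$ for $x\in\mathbb{R}^n$ and $\tau(C)=\{\tau(x):x\in C\}$ for $C\subseteq\mathbb{R}^n$; the empty list is allowed. For another list $\tau'=(i'_1,\dots,i'_{k'})$, write $\tau\trianglelefteq\tau'$ if $k\le k'$ and $i_j=i'_j$ for all $1\le j\le k$. For a node $v$ of a directed graph, $\delta^+(v)$ is its set of children. Branching tree: a tuple $\mathcal{T}=(V,E,B,\sigma)$ is a $\mathcal{C}$-consistent branching tree if: (T1) $(V,E)$ is an arborescence with $1\le|V|<\infty$ and root $r\in V$. (T2) Each $v\in V$ has a branching constraint $B_v\subseteq\mathbb{R}^n$, and $B_r=\mathbb{R}^n$. (T3) For all $u\in V$ with $\delta^+(u)\ne\emptyset$: $\bigcap\mathcal{C}\subseteq\bigcup_{v\in\delta^+(u)}B_v$.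 (T4) Each $v\in V$ has a list $\sigma_v\in\{\pm1,\dots,\pm n\}^{\ell_v}$, $\ell_v\in\{0,\dots,n\}$, with $|(\sigma_v)_1|,\dots,|(\sigma_v)_{\ell_v}|$ pairwise distinct. (T5) $\sigma_u\trianglelefteq\sigma_v$ for all $u\in V$, $v\in\delta^+(u)$. (T6) For all $v\in V$ and $1\le i\le\ell_v$: $\max\{\sigma_v(x)_i:x\in\bigcap\mathcal{C}\}<\infty$ (i.e. the set is bounded above). (T7) For all $u\in V$ and $v\ne w$ in $\delta^+(u)$: $\sigma_u(B_v)\cap\sigma_u(B_w)=\emptyset$. Relations: for $v\in V$ let $\mathcal{B}_v=\{B_u: u \text{ is a node on the } r\text{-}v\text{-path in } \mathcal{T}\}$. For $x,y\in\bigcap\mathcal{C}$ let $\mathrm{dcn}(x,y)$ be the deepest node $w\in V$ with $x,y\in\bigcap(\mathcal{C}\cup\mathcal{B}_w)$. For $\epsilon>0$ and $a,b\in\mathbb{R}^k$, let $a\succ_\epsilon b$ mean $a\neq b$ and $a_i\ge b_i+\epsilon$ for the smallest index $i$ with $a_i\ne b_i$. For $x,y\in\bigcap\mathcal{C}$ and $v=\mathrm{dcn}(x,y)$: $x\succeq_{\epsilon,\mathcal{T}}y$ iff $\sigma_v(x)=\sigma_v(y)$ or $\sigma_v(x)\succ_\epsilon\sigma_v(y)$; $x\succ_{\epsilon,\mathcal{T}}y$ iff $\sigma_v(x)\succ_\epsilon\sigma_v(y)$. Configuration: let $F\subseteq\mathbb{R}^n$, $f\colon\mathbb{R}^n\to\mathbb{R}$.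 A configuration $(\mathcal{C},\mathcal{D},g,z,\mathcal{T},\epsilon)$ with $\mathcal{C},\mathcal{D}\subseteq\mathcal{P}(\mathbb{R}^n)$, $g\colon\mathbb{R}^n\to\mathbb{R}$, $z\in\mathbb{R}\cup\{\infty\}$, $\mathcal{T}$ a branching tree and $\epsilon$ a real number is $(F,f)$-valid if: (V1) $\mathcal{T}$ is $\mathcal{C}$-consistent and $\epsilon>0$. (V2) If $z<\infty$, there exists $x\in F$ with $f(x)\le z$. (V3) For all real $\hat z<z$, there exists $x\in F$ with $f(x)\le\hat z$ if and only if there exists $x\in\bigcap\mathcal{C}$ with $g(x)\le\hat z$. (V4) For every $x\in\bigcap\mathcal{C}$ with $g(x)<z$ there exists $y\in\bigcap(\mathcal{C}\cup\mathcal{D})$ with $y\succeq_{\epsilon,\mathcal{T}}x$ and $g(y)\le g(x)$. *)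

(* Defs.v *)
From mathcomp Require Import all_boot all_order all_algebra.
From mathcomp Require Import all_classical all_reals.

Set Implicit Arguments.
Unset Strict Implicit.
Unset Printing Implicit Defensive.

Import Order.TTheory GRing.Theory Num.Theory.

Local Open Scope classical_set_scope.
Local Open Scope ring_scope.

(* An element of {±1, ..., ±n}, as (is it negative?, its absolute value);
   absolute values are shifted to 0, ..., n-1. *)
Definition signed_index (n : nat) : Type := (bool * 'I_n)%type.

Definition apply_list (R : realType) (n : nat) (tau : seq (signed_index n))
    (x : 'rV[R]_n) : 'rV[R]_(size tau) :=
  \row_(j < size tau)
    let i := tnth (in_tuple tau) j in (-1) ^+ i.1 * x ord0 i.2.

Definition all_of (R : realType) (n : nat) (CC : set (set 'rV[R]_n)) :
    set 'rV[R]_n :=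
  \bigcap_(C in CC) C.

Record branching_tree (R : realType) (n : nat) := BranchingTree {
  node : finType;
  edge : rel node;
  root : node;
  bconstr : node -> set 'rV[R]_n;
  blist : node -> seq (signed_index n)
}.

(* [path] allows repeated nodes, so this asks for a unique directed walk from
   the root to every node, which excludes cycles, loops and edges into the
   root. *)
Definition arborescence (V : finType) (E : rel V) (r : V) : Prop :=
  forall v : V, exists! p : seq V, path E r p /\ last r p = v.

Definition children (R : realType) (n : nat) (T : branching_tree R n)
    (u : node T) : set (node T) :=
  [set v | edge u v].

Record consistent (R : realType) (n : nat) (CC : set (set 'rV[R]_n))
    (T : branching_tree R n) : Prop := Consistent {
  consistent_arborescence : arborescence (@edge R n T) (root T);
  consistent_root : bconstr (root T) = setT;
  consistent_cover : forall u : node T, children u !=set0 ->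
    all_of CC `<=` \bigcup_(v in children u) bconstr v;
  consistent_size : forall v : node T, (size (blist v) <= n)%N;
  consistent_uniq : forall v : node T, uniq [seq i.2 | i <- blist v];
  consistent_prefix : forall u v : node T, children u v ->
    prefix (blist u) (blist v);
  consistent_bounded : forall (v : node T) (i : 'I_(size (blist v))),
    has_ubound [set apply_list (blist v) x ord0 i | x in all_of CC];
  consistent_disjoint : forall u v w : node T,
    children u v -> children u w -> v <> w ->
    (apply_list (blist u) @` bconstr v) `&`
    (apply_list (blist u) @` bconstr w) = set0
}.

(* The nodes following the root on the path from the root to [v]; the default
   [::] is irrelevant when the graph is an arborescence. *)
Definition root_path (R : realType) (n : nat) (T : branching_tree R n)
    (v : node T) : seq (node T) :=
  xget [::] [set p | path (@edge R n T) (root T) p /\ last (root T) p = v].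

Definition depth (R : realType) (n : nat) (T : branching_tree R n)
    (v : node T) : nat :=
  size (root_path v).

Definition path_constrs (R : realType) (n : nat) (T : branching_tree R n)
    (v : node T) : set (set 'rV[R]_n) :=
  [set B | exists2 u : node T,
     u \in root T :: root_path v & B = bconstr u].

Definition common_node (R : realType) (n : nat) (CC : set (set 'rV[R]_n))
    (T : branching_tree R n) (x y : 'rV[R]_n) (w : node T) : Prop :=
  all_of (CC `|` path_constrs w) x /\ all_of (CC `|` path_constrs w) y.

(* Only meaningful for a consistent tree and x, y satisfying all of CC, where
   the deepest common node is unique, see [dcn_deepest] and [dcn_unique]. *)
Definition dcn (R : realType) (n : nat) (CC : set (set 'rV[R]_n))
    (T : branching_tree R n) (x y : 'rV[R]_n) : node T :=
  [arg max_(w > root T | `[< common_node CC x y w >]) depth w].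

Definition lex_gt (R : realType) (eps : R) (k : nat) (a b : 'rV[R]_k) : Prop :=
  exists i : 'I_k,
    [/\ a ord0 i <> b ord0 i,
        forall j : 'I_k, (j < i)%N -> a ord0 j = b ord0 j &
        b ord0 i + eps <= a ord0 i].

Definition tree_ge (R : realType) (n : nat) (CC : set (set 'rV[R]_n))
    (T : branching_tree R n) (eps : R) (x y : 'rV[R]_n) : Prop :=
  let s := blist (dcn CC T x y) in
  apply_list s x = apply_list s y \/
  lex_gt eps (apply_list s x) (apply_list s y).

Record configuration (R : realType) (n : nat) := Configuration {
  cfgC : set (set 'rV[R]_n);
  cfgD : set (set 'rV[R]_n);
  cfg_g : 'rV[R]_n -> R;
  cfg_z : \bar R;
  cfg_z_neqNy : cfg_z != -oo%E;
  cfg_tree : branching_tree R n;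
  cfg_eps : R
}.

Record valid (R : realType) (n : nat) (F : set 'rV[R]_n) (f : 'rV[R]_n -> R)
    (K : configuration R n) : Prop := Valid {
  valid_consistent : consistent (cfgC K) (cfg_tree K);
  valid_eps : 0 < cfg_eps K;
  valid_upper : (cfg_z K < +oo)%E ->
    exists2 x : 'rV[R]_n, F x & ((f x)%:E <= cfg_z K)%E;
  valid_equiv : forall zh : R, (zh%:E < cfg_z K)%E ->
    (exists2 x : 'rV[R]_n, F x & f x <= zh) <->
    (exists2 x : 'rV[R]_n, all_of (cfgC K) x & cfg_g K x <= zh);
  valid_dominance : forall x : 'rV[R]_n,
    all_of (cfgC K) x -> ((cfg_g K x)%:E < cfg_z K)%E ->
    exists y : 'rV[R]_n,
      [/\ all_of (cfgC K `|` cfgD K) y,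
          tree_ge (cfgC K) (cfg_tree K) (cfg_eps K) y x &
          cfg_g K y <= cfg_g K x]
}.

Lemma root_pathP (R : realType) (n : nat) (T : branching_tree R n)
    (p : seq (node T)) (v : node T) :
  arborescence (@edge R n T) (root T) ->
  path (@edge R n T) (root T) p /\ last (root T) p = v <-> p = root_path v.
Proof.
move=> /(_ v)[q [hq uq]].
have E : root_path v = q.
  by rewrite /root_path; case: xgetP => [s _ /uq->//|/(_ q)].
by rewrite E; split=> [/uq|->].
Qed.

Lemma common_node_root (R : realType) (n : nat) (CC : set (set 'rV[R]_n))
    (T : branching_tree R n) (x y : 'rV[R]_n) :
  consistent CC T -> all_of CC x -> all_of CC y ->
  common_node CC x y (root T).
Proof.
move=> cT Cx Cy.
have E : [::] = root_path (root T).
  by apply/(root_pathP _ _ (consistent_arborescence cT)).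
suff H z : all_of CC z -> all_of (CC `|` path_constrs (root T)) z.
  by split; apply: H.
move=> Cz B [/Cz//|[u]]; rewrite -E inE => /eqP-> ->.
by rewrite (consistent_root cT).
Qed.

Lemma dcn_deepest (R : realType) (n : nat) (CC : set (set 'rV[R]_n))
    (T : branching_tree R n) (x y : 'rV[R]_n) :
  consistent CC T -> all_of CC x -> all_of CC y ->
  common_node CC x y (dcn CC T x y) /\
  forall w : node T, common_node CC x y w -> (depth w <= depth (dcn CC T x y))%N.
Proof.
move=> cT Cx Cy; rewrite /dcn; case: arg_maxnP => [|w /asboolP cw max].
  exact/asboolP/common_node_root.
by split=> // w' cw'; apply/max/asboolP.
Qed.

Lemma dcn_unique (R : realType) (n : nat) (CC : set (set 'rV[R]_n))
    (T : branching_tree R n) (x y : 'rV[R]_n) (v : node T) :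
  consistent CC T -> all_of CC x -> all_of CC y ->
  common_node CC x y v ->
  (forall w : node T, common_node CC x y w -> (depth w <= depth v)%N) ->
  v = dcn CC T x y.
Proof.
move=> cT Cx Cy cv maxv.
have [cd maxd] := dcn_deepest cT Cx Cy.
move: (dcn CC T x y) cd maxd => d cd maxd.
have arb := consistent_arborescence cT.
have eqd : size (root_path v) = size (root_path d).
  by apply/eqP; rewrite eqn_leq; apply/andP; split; [exact: maxd|exact: maxv].
have [pv lv] := (root_pathP (root_path v) v arb).2 erefl.
have [pd ld] := (root_pathP (root_path d) d arb).2 erefl.
have Bv u : u \in root_path v -> bconstr u x.
  by move=> uv; apply: cv.1; right; exists u; rewrite // inE uv orbT.
have Bd u : u \in root_path d -> bconstr u x.
  by move=> ud; apply: cd.1; right; exists u; rewrite // inE ud orbT.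
suff E : root_path v = root_path d by rewrite -lv -ld E.
move: (root_path v) (root_path d) (root T) eqd pv pd Bv Bd {lv ld}.
elim=> [|a p IH] [|b q] //= r [eqpq] /andP[ra pa] /andP[rb qb] Bp Bq.
have ab : a = b.
  case: (eqVneq a b) => // /eqP nab.
  have /seteqP[+ _] := consistent_disjoint cT ra rb nab.
  move=> /(_ (apply_list (blist r) x))[]; split; exists x => //.
    by apply: Bp; rewrite mem_head.
  by apply: Bq; rewrite mem_head.
rewrite -ab in qb *; congr cons; apply: (IH q a) => // u us.
  by apply: Bp; rewrite inE us orbT.
by apply: Bq; rewrite inE us orbT.
Qed.

(* Main.v *)
Require Import Defs.
From mathcomp Require Import all_boot all_order all_algebra.
From mathcomp Require Import all_classical all_reals.

Set Implicit Arguments.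
Unset Strict Implicit.
Unset Printing Implicit Defensive.

Local Open Scope classical_set_scope.
Local Open Scope ring_scope.

Theorem theorem1 (R : realType) (n : nat) (F : set 'rV[R]_n)
    (f : 'rV[R]_n -> R) (K : configuration R n) (hK : valid F f K)
    (hD : cfgD K set0) :
  ~ (exists2 x : 'rV[R]_n, F x & ((f x)%:E < cfg_z K)%E).
Proof.
move=> [x Fx fxz].
(* The equivalence at the threshold [f x] turns [x] into a solution of the
   transformed problem that still improves on the incumbent value. *)
have [x' Cx' gx'] := (valid_equiv hK fxz).1 (ex_intro2 _ _ x Fx (Order.POrderTheory.lexx _)).
have gx'z : ((cfg_g K x')%:E < cfg_z K)%E.
  by apply: Order.POrderTheory.le_lt_trans fxz; rewrite lee_fin.
(* A dominating point would have to satisfy the unsatisfiable constraint. *)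
have [y [CDy _ _]] := valid_dominance hK Cx' gx'z.
exact: (CDy set0 (or_intror hD)).
Qed.
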